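(* Let $n\ge 3$ and, for $0\le k\le n$, let \[ Q_{n,k}=\binom{n}{k}\,\mathbb{P}(K_n>k). \] Then $Q_{n,0}=1$, and for $1\le k\le n$, \[ Q_{n,k}=n\,[x^k y^{n-k}]\,\log\left(\frac{1}{1-\frac{e^{2x}-1}{2}\cdot\frac{y^2}{1-y}}\right), \] where $[x^k y^{n-k}]$ denotes extraction of the coefficient of $x^k y^{n-k}$ in the formal power series in $x,y$ over $\mathbb{Q}$.
   Context: Let $n\ge 3$ and let $C_n$ be the cycle graph on vertex set $\mathbb{Z}/n\mathbb{Z}$ ($v$ is adjacent to $v-1$ and $v+1$). Let $\pi=(\pi_1,\dots,\pi_n)$ be a uniformly random permutation (ordering) of the vertices, and $A_t=\{\pi_1,\dots,\pi_t\}$ for $0\le t\le n$. A vertex $v\in A_t$ is isolated at time $t$ if neither neighbor of $v$ lies in $A_t$. Define $\tau_n=\max\{t: \text{the induced subgraph } C_n[A_t]\text{ contains an isolated vertex}\}$ and $K_n=n-\tau_n$. *)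

(* Defs.v *)
From HB Require Import structures.
From mathcomp Require Import all_boot all_order all_algebra.
From mathcomp Require Import boolp.

Set Implicit Arguments.
Unset Strict Implicit.
Unset Printing Implicit Defensive.

Import Order.TTheory GRing.Theory Num.Theory.
Local Open Scope ring_scope.

(* Elements of Q[[x, y]]; [coefxy f i j] is the coefficient of x^i y^j in [f]. *)
Record fps2 := Fps2 { coefxy : nat -> nat -> rat }.

Lemma fps2P (f g : fps2) : coefxy f =2 coefxy g -> f = g.
Proof.
case: f g => [f] [g] /= fg; congr Fps2.
by apply: functional_extensionality_dep => i; apply/funext => j.
Qed.

HB.instance Definition _ := gen_eqMixin fps2.
HB.instance Definition _ := gen_choiceMixin fps2.

Definition fps2_const (c : rat) : fps2 :=
  Fps2 (fun i j => if (i == 0%N) && (j == 0%N) then c else 0).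

Definition fps2_add (f g : fps2) : fps2 :=
  Fps2 (fun i j => coefxy f i j + coefxy g i j).

Definition fps2_opp (f : fps2) : fps2 := Fps2 (fun i j => - coefxy f i j).

Definition fps2_mul (f g : fps2) : fps2 :=
  Fps2 (fun i j => \sum_(a < i.+1) \sum_(b < j.+1)
          coefxy f a b * coefxy g (i - a) (j - b)).

Fact fps2_addA : associative fps2_add.
Proof. by move=> f g h; apply: fps2P => i j /=; rewrite addrA. Qed.

Fact fps2_addC : commutative fps2_add.
Proof. by move=> f g; apply: fps2P => i j /=; rewrite addrC. Qed.

Fact fps2_add0 : left_id (fps2_const 0) fps2_add.
Proof. by move=> f; apply: fps2P => i j /=; rewrite if_same add0r. Qed.

Fact fps2_addN : left_inverse (fps2_const 0) fps2_opp fps2_add.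
Proof. by move=> f; apply: fps2P => i j /=; rewrite if_same addNr. Qed.

HB.instance Definition _ :=
  GRing.isZmodule.Build fps2 fps2_addA fps2_addC fps2_add0 fps2_addN.

(* The coefficients of a product only depend on truncations of the factors, so
   the ring axioms are transported from polynomials. *)
Definition fps2_trunc (N : nat) (f : fps2) : {poly {poly rat}} :=
  \poly_(j < N) \poly_(i < N) coefxy f i j.

Lemma coef_fps2_trunc N f i j : (i < N)%N -> (j < N)%N ->
  (fps2_trunc N f)`_j`_i = coefxy f i j.
Proof. by move=> iN jN; rewrite coef_poly jN coef_poly iN. Qed.

Lemma coef2M (p q : {poly {poly rat}}) i j :
  (p * q)`_j`_i =
    \sum_(a < i.+1) \sum_(b < j.+1) p`_b`_a * q`_(j - b)`_(i - a).
Proof.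
rewrite coefM coef_sum exchange_big /=.
by apply: eq_bigr => b _; rewrite coefM.
Qed.

Lemma coef_fps2_truncM N f g i j : (i < N)%N -> (j < N)%N ->
  (fps2_trunc N f * fps2_trunc N g)`_j`_i = coefxy (fps2_mul f g) i j.
Proof.
move=> iN jN; rewrite coef2M; apply: eq_bigr => a _; apply: eq_bigr => b _.
have aN : (a < N)%N by apply: leq_ltn_trans iN; rewrite -ltnS.
have bN : (b < N)%N by apply: leq_ltn_trans jN; rewrite -ltnS.
by rewrite !coef_fps2_trunc // (leq_ltn_trans (leq_subr _ _)).
Qed.

Fact fps2_mulC : commutative fps2_mul.
Proof.
move=> f g; apply: fps2P => i j; pose N := (i + j).+1.
have iN : (i < N)%N by rewrite ltnS leq_addr.
have jN : (j < N)%N by rewrite ltnS leq_addl.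
by rewrite -!(@coef_fps2_truncM N) // mulrC.
Qed.

Fact fps2_mulA : associative fps2_mul.
Proof.
move=> f g h; apply: fps2P => i j; pose N := (i + j).+1.
have iN : (i < N)%N by rewrite ltnS leq_addr.
have jN : (j < N)%N by rewrite ltnS leq_addl.
pose F := fps2_trunc N f; pose G := fps2_trunc N g; pose H := fps2_trunc N h.
have aN (a : 'I_i.+1) : (a < N)%N by apply: leq_ltn_trans iN; rewrite -ltnS.
have bN (b : 'I_j.+1) : (b < N)%N by apply: leq_ltn_trans jN; rewrite -ltnS.
transitivity ((F * (G * H))`_j`_i); [|rewrite mulrA]; rewrite coef2M;
  apply: eq_bigr => a _; apply: eq_bigr => b _.
- by rewrite coef_fps2_trunc // coef_fps2_truncM //
    (leq_ltn_trans (leq_subr _ _)).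
- by rewrite coef_fps2_truncM // coef_fps2_trunc //
    (leq_ltn_trans (leq_subr _ _)).
Qed.

Lemma coef_fps2_constM c f i j :
  coefxy (fps2_mul (fps2_const c) f) i j = c * coefxy f i j.
Proof.
rewrite /= (bigD1 ord0) //= (bigD1 ord0) //= !subn0 !big1 ?addr0 //.
- by move=> a a0; rewrite big1 // => b _; rewrite -val_eqE /= in a0;
    rewrite (negPf a0) mul0r.
- by move=> b b0; rewrite -val_eqE /= in b0; rewrite (negPf b0) mul0r.
Qed.

Fact fps2_mul1 : left_id (fps2_const 1) fps2_mul.
Proof. by move=> f; apply: fps2P => i j; rewrite coef_fps2_constM mul1r. Qed.

Fact fps2_mulDl : left_distributive fps2_mul fps2_add.
Proof.
move=> f g h; apply: fps2P => i j /=; rewrite -big_split; apply: eq_bigr => a _.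
by rewrite -big_split; apply: eq_bigr => b _; rewrite mulrDl.
Qed.

Fact fps2_1neq0 : fps2_const 1 != fps2_const 0.
Proof. by apply/eqP => /(congr1 (fun f => coefxy f 0 0)). Qed.

HB.instance Definition _ := GRing.Zmodule_isComNzRing.Build fps2
  fps2_mulA fps2_mulC fps2_mul1 fps2_mulDl fps2_1neq0.

Lemma coefxy1 i j : coefxy 1 i j = ((i == 0%N) && (j == 0%N))%:R.
Proof. by rewrite /=; case: ifP. Qed.

Lemma coefxyD f g i j : coefxy (f + g) i j = coefxy f i j + coefxy g i j.
Proof. by []. Qed.

Lemma coefxyN f i j : coefxy (- f) i j = - coefxy f i j.
Proof. by []. Qed.

Lemma coefxyB f g i j : coefxy (f - g) i j = coefxy f i j - coefxy g i j.
Proof. by []. Qed.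

Lemma coefxy0 i j : coefxy 0 i j = 0.
Proof. by rewrite /= if_same. Qed.

Lemma coefxyM f g i j : coefxy (f * g) i j =
  \sum_(a < i.+1) \sum_(b < j.+1) coefxy f a b * coefxy g (i - a) (j - b).
Proof. by []. Qed.

Lemma coefxyCM c f i j : coefxy (fps2_const c * f) i j = c * coefxy f i j.
Proof. exact: coef_fps2_constM. Qed.

Lemma coefxy_sum (I : Type) (r : seq I) (P : pred I) (F : I -> fps2) i j :
  coefxy (\sum_(k <- r | P k) F k) i j = \sum_(k <- r | P k) coefxy (F k) i j.
Proof.
apply: (big_morph (fun f => coefxy f i j)); last exact: coefxy0.
by move=> f g; rewrite coefxyD.
Qed.

(* Invertible series, with their inverse; [fps2_unitE] below identifies them as
   the series with nonzero constant term. *)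
Definition fps2_unit : {pred fps2} := fun f => `[< exists g, g * f = 1 >].

Definition fps2_inv (f : fps2) : fps2 :=
  if pselect (exists g, g * f = 1) is left fU then projT1 (cid fU) else f.

Fact fps2_mulVx : {in fps2_unit, left_inverse 1 fps2_inv *%R}.
Proof.
move=> f /asboolP fU; rewrite /fps2_inv; case: pselect => // fU'.
exact: projT2 (cid fU').
Qed.

Fact fps2_unitPl (f g : fps2) : g * f = 1 -> fps2_unit f.
Proof. by move=> gf; apply/asboolP; exists g. Qed.

Fact fps2_inv_out : {in [predC fps2_unit], fps2_inv =1 id}.
Proof.
move=> f /negP fU; rewrite /fps2_inv; case: pselect => // fU'.
by case: fU; apply/asboolP.
Qed.

HB.instance Definition _ := GRing.ComNzRing_hasMulInverse.Build fps2
  fps2_mulVx fps2_unitPl fps2_inv_out.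

Definition fpsX : fps2 :=
  Fps2 (fun i j => ((i == 1%N) && (j == 0%N))%:R).

Definition fpsY : fps2 :=
  Fps2 (fun i j => ((i == 0%N) && (j == 1%N))%:R).

(* The series sum_m a_m f^m, meaningful when [f] has zero constant term: then
   f^m has no term of total degree less than m (see [coefxyX_eq0]), so that the
   sum defining each coefficient may be truncated. *)
Definition fps2_subst (a : nat -> rat) (f : fps2) : fps2 :=
  Fps2 (fun i j => \sum_(m < (i + j).+1) a m * coefxy (f ^+ m) i j).

(* Meaningful when [f] has zero constant term. *)
Definition fps2_exp (f : fps2) : fps2 :=
  fps2_subst (fun m => (m`!)%:R^-1) f.

(* log (1 + g) = sum_(m >= 1) (-1)^(m-1) g^m / m with g = f - 1; meaningful when
   [f] has constant term 1. The term m = 0 vanishes because 0^-1 = 0. *)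
Definition fps2_log (f : fps2) : fps2 :=
  fps2_subst (fun m => (-1) ^+ m.-1 * m%:R^-1) (f - 1).

Lemma coefxyX_eq0 f m i j : coefxy f 0 0 = 0 -> (i + j < m)%N ->
  coefxy (f ^+ m) i j = 0.
Proof.
move=> f0; elim: m i j => [|m IH] i j // ijm.
rewrite exprS coefxyM big1 // => a _; rewrite big1 // => b _.
have [->|a0] := posnP a; first have [->|b0] := posnP b.
- by rewrite f0 mul0r.
- rewrite IH ?mulr0 // subn0; have bj : (b <= j)%N by rewrite -ltnS.
  by apply: leq_trans (_ : i + j <= m)%N => //; rewrite ltn_add2l ltn_subrL b0;
    apply: leq_trans bj.
- rewrite IH ?mulr0 //; have ai : (a <= i)%N by rewrite -ltnS.
  apply: leq_trans (_ : i + j <= m)%N => //.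
  by rewrite -addSn leq_add ?leq_subr // ltn_subrL a0; apply: leq_trans ai.
Qed.

Lemma coefxy_subst a f i j N : coefxy f 0 0 = 0 -> (i + j < N)%N ->
  coefxy (fps2_subst a f) i j = \sum_(m < N) a m * coefxy (f ^+ m) i j.
Proof.
move=> f0 ijN; rewrite /= (big_ord_widen N (fun m => a m * coefxy (f ^+ m) i j)) //.
rewrite big_mkcond; apply: eq_bigr => m _; case: ifPn => //.
by rewrite -leqNgt => ijm; rewrite coefxyX_eq0 ?mulr0.
Qed.

Lemma fps2_geometric f : coefxy f 0 0 = 0 ->
  fps2_subst (fun=> 1) f * (1 - f) = 1.
Proof.
move=> f0; apply: fps2P => i j; pose N := (i + j).+1.
transitivity (coefxy ((\sum_(m < N) f ^+ m) * (1 - f)) i j).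
  rewrite !coefxyM; apply: eq_bigr => a _; apply: eq_bigr => b _; congr (_ * _).
  rewrite (@coefxy_subst _ _ _ _ N) //; last by rewrite ltnS leq_add // -ltnS.
  by rewrite coefxy_sum; apply: eq_bigr => m _; rewrite mul1r.
rewrite mulrC -[1 - f]opprB mulNr -subrX1 opprB coefxyB coefxyX_eq0 ?subr0 //.
Qed.

Lemma fps2_unitE f : (f \is a GRing.unit) = (coefxy f 0 0 != 0).
Proof.
apply/idP/idP => [fU|f0].
  have /(congr1 (fun h => coefxy h 0 0)) := mulVr fU.
  rewrite coefxyM !big_ord1 subnn coefxy1 /=.
  by case: (eqVneq (coefxy f 0 0) 0) => // ->; rewrite mulr0.
pose c := (coefxy f 0 0)^-1; pose h := 1 - fps2_const c * f.
have h0 : coefxy h 0 0 = 0.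
  by rewrite coefxyB coefxyCM coefxy1 mulVf ?subrr.
have := fps2_geometric h0; rewrite subKr mulrA => /fps2_unitPl; exact.
Qed.

(* For [n >= 2], ['Z_n] is Z/nZ. *)
Definition cycle_adj (n : nat) : rel 'Z_n :=
  fun u v => (v == u - 1) || (v == u + 1).

Definition isolated_in (n : nat) (A : {set 'Z_n}) (v : 'Z_n) : bool :=
  (v \in A) && [forall u, cycle_adj v u ==> (u \notin A)].

Definition has_isolated (n : nat) (A : {set 'Z_n}) : bool :=
  [exists v, isolated_in A v].

(* Orderings of the vertices: as ['Z_n] has n elements for [n >= 2], these are
   the duplicate-free n-tuples. *)
Definition orderings (n : nat) : {set n.-tuple 'Z_n} :=
  [set s : n.-tuple 'Z_n | uniq s].

Definition occupied (n : nat) (s : n.-tuple 'Z_n) (t : nat) : {set 'Z_n} :=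
  [set v in take t s].

(* For [n >= 3] the maximum is over a nonempty set, containing t = 1. *)
Definition tau (n : nat) (s : n.-tuple 'Z_n) : nat :=
  \max_(t < n.+1 | has_isolated (occupied s t)) t.

Definition K (n : nat) (s : n.-tuple 'Z_n) : nat := (n - tau s)%N.

(* The uniform law on orderings only takes rational values. *)
Definition Pr (n : nat) (E : pred (n.-tuple 'Z_n)) : rat :=
  #|[set s in orderings n | E s]|%:R / #|orderings n|%:R.

Definition Q (n k : nat) : rat :=
  'C(n, k)%:R * Pr (fun s : n.-tuple 'Z_n => (k < K s)%N).

(* Main.v *)
Require Import Defs.
From mathcomp Require Import all_boot all_order all_algebra.
From mathcomp Require Import ring zify.
Import GRing.Theory.
Local Open Scope ring_scope.
Set Implicit Arguments.
Unset Strict Implicit.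

(** Read an ordering backwards, as a removal of the vertices of the cycle one
    at a time. Then K > k says that after each of the first k removals no
    remaining vertex is isolated. A good sequence of k removals extends to
    (n - k)! orderings, so Q n k is the number of good sequences of k removals
    divided by k! ([Q_removal_count]).

    Let B be the set of the removed vertices, and suppose that no vertex
    outside B is isolated, that is, that all gaps between consecutive runs of B
    have length at least 2. An order of removal of B is good when no vertex
    outlives both its neighbours. In a run of length l there are 2^(l-1) such
    orders, since, read backwards, each removal takes one of the two ends of
    what is left of the run. The orders of different runs are shuffled freely,
    so B has |B|! times the product of the
    2^(l-1)/l! good orders. [removal_count_word] obtains this without
    shuffles, by induction on the vertex removed last: it is an end of a run.
    For l >= 2 the two ends of a run of length l contribute
    2 * 2^(l-2)/(l-1)! = l * 2^(l-1)/l!, a run of length 1 contributes 1, and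
    the sum of the lengths l is |B| ([sum_word_weight_exposed]).

    It remains to sum the product of the 2^(l-1)/l! over the sets B of size k
    with gaps of length at least 2. Divide the weight of B equally among its
    m runs, and rotation the first vertex of the chosen run to 0: the sum is n
    times the sum of weight/m over the sets having a run that starts at 0
    ([sum_removal_count_cut]). Such a set, read from 0, is a sequence of m
    pairs consisting of a run and a gap. With x marking removed and y marking
    remaining vertices, the pairs have generating function
      H = (e^(2x) - 1)/2 * y^2/(1 - y),
    so that the sum is n [x^k y^(n-k)] sum_m H^m/m ([word_gf_block_scan]).
    This series is log (1/(1 - H)), because both have the same image under the
    Euler derivation x d/dx + y d/dy ([coefxy_log_inv]). *)

(** * Logarithms of bivariate power series *)

(** The derivation x d/dx + y d/dy. *)
Definition euler (f : fps2) : fps2 :=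
  Fps2 (fun i j => (i + j)%:R * coefxy f i j).

Lemma coefxy_euler f i j : coefxy (euler f) i j = (i + j)%:R * coefxy f i j.
Proof. by []. Qed.

Lemma eulerM f g : euler (f * g) = euler f * g + f * euler g.
Proof.
apply: fps2P => i j; rewrite coefxyD !coefxyM coefxy_euler coefxyM -big_split.
rewrite mulr_sumr; apply: eq_bigr => a _; rewrite -big_split mulr_sumr.
apply: eq_bigr => b _; rewrite !coefxy_euler.
have -> : (i + j = (a + b) + ((i - a) + (j - b)))%N.
  by have := ltn_ord a; have := ltn_ord b; lia.
rewrite natrD /=; ring.
Qed.

Lemma eulerD f g : euler (f + g) = euler f + euler g.
Proof. by apply: fps2P => i j; rewrite coefxyD !coefxy_euler coefxyD mulrDr. Qed.

Lemma euler1 : euler 1 = 0.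
Proof.
apply: fps2P => i j; rewrite coefxy_euler coefxy1 coefxy0.
by have [->|ij] := eqVneq (i + j)%N 0%N;
  rewrite ?mul0r // -addn_eq0 (negPf ij) mulr0.
Qed.

Lemma eulerN f : euler (- f) = - euler f.
Proof. by apply: fps2P => i j; rewrite coefxyN !coefxy_euler coefxyN mulrN. Qed.

Lemma eulerX f m : euler (f ^+ m.+1) = m.+1%:R * f ^+ m * euler f.
Proof.
elim: m => [|m IH]; first by rewrite expr0 !mul1r expr1.
rewrite exprS eulerM IH -[in RHS](natr1 m.+1) exprS; ring.
Qed.

Lemma fps2_natr m : m%:R = fps2_const m%:R :> fps2.
Proof.
apply: fps2P => i j; elim: m => [|m IH]; first by rewrite !mulr0n.
rewrite mulrSr coefxyD IH coefxy1 /= [m.+1%:R]mulrSr.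
by case: (_ && _); rewrite ?addr0.
Qed.

(** The chain rule: f^(m+1) has image (m + 1) f^m * euler f. *)
Lemma euler_subst a f : coefxy f 0 0 = 0 ->
  euler (fps2_subst a f) =
    fps2_subst (fun m => m.+1%:R * a m.+1) f * euler f.
Proof.
move=> f0; apply: fps2P => i j; pose N := (i + j).+1.
transitivity (coefxy
    ((\sum_(m < N) fps2_const (m.+1%:R * a m.+1) * f ^+ m) * euler f) i j).
  rewrite mulr_suml coefxy_sum coefxy_euler (@coefxy_subst _ _ _ _ N.+1) //.
  rewrite big_ord_recl expr0 mulrDr mulr_sumr.
  rewrite [X in X + _](_ : _ = 0); last first.
    have [->|ij] := eqVneq (i + j)%N 0%N; first by rewrite mul0r.
    by rewrite coefxy1 -addn_eq0 (negPf ij) !mulr0.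
  rewrite add0r; apply: eq_bigr => m _.
  rewrite mulrCA -coefxy_euler eulerX -!mulrA coefxyCM fps2_natr coefxyCM.
  by rewrite mulrCA !mulrA.
rewrite !coefxyM; apply: eq_bigr => x _; apply: eq_bigr => y _; congr (_ * _).
rewrite (@coefxy_subst _ _ _ _ N) //; last by rewrite ltnS leq_add // -ltnS.
by rewrite coefxy_sum; apply: eq_bigr => m _; rewrite coefxyCM.
Qed.

Lemma eq_fps2_subst a b f : a =1 b -> fps2_subst a f = fps2_subst b f.
Proof.
by move=> ab; apply: fps2P => i j; apply: eq_bigr => m _; rewrite ab.
Qed.

Lemma fps2_subst_opp a f :
  fps2_subst a (- f) = fps2_subst (fun m => (-1) ^+ m * a m) f.
Proof.
apply: fps2P => i j; apply: eq_bigr => m _.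
rewrite (exprNn f) -(signr_odd fps2) -(signr_odd rat).
by case: (odd m); rewrite ?expr1 ?expr0 ?mul1r // !mulN1r coefxyN mulrN mulNr.
Qed.

(** With e = 1/(1 - h), the Euler derivative of log e is euler e / e, and that
    of the sum of the h^m/m is euler h / (1 - h); both are equal to e * euler
    h since euler e = e^2 * euler h. Only the constant term is lost under the
    derivation. *)
Lemma coefxy_log_inv h i j : coefxy h 0 0 = 0 -> (0 < i + j)%N ->
  coefxy (fps2_log (1 / (1 - h))) i j =
    coefxy (fps2_subst (fun m => m%:R^-1) h) i j.
Proof.
move=> h0 ij0.
have hU : (1 - h) \is a GRing.unit.
  by rewrite fps2_unitE coefxyB coefxy1 h0 subr0 oner_eq0.
set e := 1 / (1 - h); have eh : e * (1 - h) = 1 by rewrite divrK.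
have e0 : coefxy e 0 0 = 1.
  move/(congr1 (fun f => coefxy f 0 0)): eh.
  by rewrite coefxyM !big_ord1 coefxyB h0 subr0 !coefxy1 mulr1.
have g0 : coefxy (e - 1) 0 0 = 0 by rewrite coefxyB e0 coefxy1 subrr.
suff E : euler (fps2_log e) = euler (fps2_subst (fun m => m%:R^-1) h).
  apply: (mulfI (x := (i + j)%:R)).
    by rewrite Num.Theory.pnatr_eq0 -lt0n.
  by rewrite -!coefxy_euler E.
rewrite !euler_subst //.
rewrite (@eq_fps2_subst _ (fun=> 1) h); last first.
  by move=> m; rewrite mulfV // Num.Theory.pnatr_eq0.
have -> : fps2_subst (fun=> 1) h = e.
  by rewrite -[LHS]mulr1 -(divrr hU) mulrA fps2_geometric.
rewrite (@eq_fps2_subst _ (fun m => (-1) ^+ m * 1) (e - 1)); last first.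
  by move=> m; rewrite mulrCA mulfV ?mulr1 // Num.Theory.pnatr_eq0.
rewrite -fps2_subst_opp.
have -> : fps2_subst (fun=> 1) (- (e - 1)) = 1 - h.
  have gN0 : coefxy (- (e - 1)) 0 0 = 0 by rewrite coefxyN g0 oppr0.
  have := fps2_geometric gN0; rewrite opprK (addrC 1) subrK => gE.
  by rewrite -[LHS]mulr1 -[X in _ * X = _]eh mulrA gE mul1r.
have /(congr1 euler) := eh; rewrite eulerM euler1 !(eulerD, eulerN, euler1).
rewrite add0r oppr0 addr0 mulrN => /eqP; rewrite subr_eq0 => /eqP <-.
by rewrite mulrC.
Qed.

(** * Weights of words and removal of the end of a run *)

(** The proportion, among the orders of a run of length l, of those in which
    no vertex outlives both its neighbours. The empty run has weight 1. *)
Definition run_weight (l : nat) : rat :=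
  if l is l'.+1 then 2 ^+ l' / (l'.+1)`!%:R else 1.

(** In a word [true] stands for a removed vertex. The product of the weights
    of the runs, where r letters [true] precede the word; as the empty run has
    weight 1, every letter [false] may close a run. *)
Fixpoint word_weight (r : nat) (s : seq bool) : rat :=
  match s with
  | [::] => run_weight r
  | true :: s' => word_weight r.+1 s'
  | false :: s' => run_weight r * word_weight 0 s'
  end.

(** Outside the word the letters count as [false]. *)
Definition exposed (s : seq bool) (i : nat) : bool :=
  ~~ (nth false (false :: s) i && nth false s i.+1).

Lemma word_weight_nseq r l s :
  word_weight r (nseq l true ++ s) = word_weight (r + l) s.
Proof. by elim: l r => [|l IH] r /=; rewrite ?addn0 // IH addSnnS. Qed.

(** Removing the letter i from a run of length l + 1 leaves runs of lengths i
    and l - i. For l > 0 both ends leave a run of length l; for l = 0 the two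
    ends coincide. *)
Lemma sum_run_ends l : \sum_(i < l.+1 | (i == 0%N :> nat) || (i == l :> nat))
    run_weight i * run_weight (l - i) = l.+1%:R * run_weight l.+1.
Proof.
case: l => [|l].
  by rewrite big_mkcond big_ord_recl big_ord0 /= addr0 expr0 !mul1r.
rewrite big_mkcond big_ord_recl big_ord_recr /= big1; last first.
  by move=> i _; rewrite /bump /= add1n eqSS (ltn_eqF (ltn_ord i)).
rewrite /bump /= add1n eqxx subnn add0r add0n mulr1 mul1r.
rewrite [(l.+2)`!]factS natrM exprS.
have f0 : (l.+1)`!%:R != 0 :> rat by rewrite Num.Theory.pnatr_eq0 -lt0n fact_gt0.
have l0 : l.+2%:R != 0 :> rat by rewrite Num.Theory.pnatr_eq0.
by field; rewrite f0 -natrD.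
Qed.

Lemma set_nth_nseq l i t : (i < l)%N ->
  set_nth false (nseq l true ++ t) i false =
    nseq i true ++ false :: nseq (l.-1 - i) true ++ t.
Proof.
elim: l i => // l IH [|i] il /=; first by rewrite subn0.
by rewrite IH //; congr (_ :: _ ++ _ :: nseq _ _ ++ _); case: l {IH} il.
Qed.

Lemma word_first_run (s : seq bool) : last false s = false -> s != [::] ->
  exists l t, s = nseq l true ++ false :: t /\ last false t = false.
Proof.
elim: s => // -[] s IH /= ls _; last by exists 0%N, s.
have [||l [t [-> lt]]] := IH; first by case: s ls {IH}.
  by case: s ls {IH}.
by exists l.+1, t.
Qed.

(** Changing an end of a run of length l to [false] only affects the weight of
    this run, and by [sum_run_ends] the ends of the run together give l times
    the weight of the word. The induction strips off the first run. The last
    letter is [false] so that each run is followed by [false]. *)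
Lemma sum_word_weight_exposed (s : seq bool) : last false s = false ->
  \sum_(0 <= i < size s | nth false s i && exposed s i)
     word_weight 0 (set_nth false s i false) =
  (count id s)%:R * word_weight 0 s.
Proof.
have [k] := ubnP (size s); elim: k s => // k IH s sk ls.
have [->|s0] := eqVneq s [::]; first by rewrite big_nil mul0r.
have [l [t [E lt]]] := word_first_run ls s0; move: sk; rewrite E => {s ls s0 E}.
set s := _ ++ _; move=> sk.
have ss : size s = (l.+1 + size t)%N by rewrite size_cat size_nseq /= addnS.
have ws : word_weight 0 s = run_weight l * word_weight 0 t.
  by rewrite word_weight_nseq.
have cs : count id s = (l + count id t)%N by rewrite count_cat count_nseq /= mul1n.
have nl i : (i < l)%N -> nth false s i = true.
  by move=> il; rewrite nth_cat size_nseq il nth_nseq il.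
have nsl : nth false s l = false by rewrite nth_cat size_nseq ltnn subnn.
have nr i : nth false s (i + l.+1) = nth false t i.
  by rewrite nth_cat size_nseq addnS ltnNge leqW ?leq_addl //= subSn ?leq_addl ?addnK.
rewrite ss (@big_cat_nat _ _ _ l.+1) //= ?leq_addr // big_mkcond big_nat_recr //=.
rewrite nsl /= addr0.
rewrite -[X in _ + \sum_(X <= _ < _ | _) _]add0n big_addn addKn.
rewrite ws cs natrD mulrDl; congr (_ + _).
  case: l @s sk ss ws cs nl nsl nr => [|l] s sk ss ws cs nl nsl nr.
    by rewrite big_nil mul0r.
  rewrite mulrA -sum_run_ends mulr_suml -big_mkcond big_mkord [RHS]big_mkcond /=.
  rewrite big_mkcond.
  apply: eq_bigr => i _; rewrite nl //= /exposed.
  have -> : nth false (false :: s) i = (i != 0%N :> nat).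
    case: i => -[|i] //= il; rewrite nl //; exact: ltnW.
  have -> : nth false s i.+1 = (i != l :> nat).
    have [->|il] := eqVneq (i : nat) l; first by [].
    by rewrite nl // ltnS ltn_neqAle il -ltnS ltn_ord.
  rewrite negb_and !negbK; case: ifP => // _.
  by rewrite set_nth_nseq //= word_weight_nseq /= add0n word_weight_nseq mulrA.
rewrite mulrCA -IH //; last by rewrite ss in sk; lia.
rewrite mulr_sumr; apply: eq_big => [i|i _].
  rewrite nr /exposed -[(i + l.+1).+1]addSn nr; case: i => [|i] /=.
    by rewrite nsl.
  by rewrite nr.
have -> : set_nth false s (i + l.+1) false =
    nseq l true ++ false :: set_nth false t i false.
  rewrite /s {nl nsl nr cs ws ss sk IH}; elim: (l) => [|l' IH]; first by rewrite addn1.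
  by rewrite addnS /= IH.
by rewrite word_weight_nseq.
Qed.

(** * Generating functions of weights on words *)

(** The sum over the words of length n with k letters [true], in a recursive
    form that follows the recursions of the weights. *)
Fixpoint word_sum (n k : nat) (phi : seq bool -> rat) : rat :=
  if n is n'.+1 then
    word_sum n' k (fun s => phi (false :: s)) +
    (if k is k'.+1 then word_sum n' k' (fun s => phi (true :: s)) else 0)
  else if k == 0%N then phi [::] else 0.

(** The letter [true] is marked by x, the letter [false] by y. *)
Definition word_gf (phi : seq bool -> rat) : fps2 :=
  Fps2 (fun i j => word_sum (i + j) i phi).

Lemma eq_word_sum n k phi psi : phi =1 psi -> word_sum n k phi = word_sum n k psi.
Proof.
elim: n k phi psi => [|n IH] k phi psi E /=; first by rewrite E.
congr (_ + _); first by apply: IH => s.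
by case: k => // k; apply: IH => s.
Qed.

Lemma word_sum_gt n k phi : (n < k)%N -> word_sum n k phi = 0.
Proof.
elim: n k phi => [|n IH] [|k] phi //= nk.
by rewrite !IH ?addr0 // ltnW.
Qed.

Lemma word_sumZ n k c phi : word_sum n k (fun s => c * phi s) = c * word_sum n k phi.
Proof.
elim: n k phi => [|n IH] [|k] phi //=; rewrite ?mulr0 // mulrDr !IH ?mulr0 //.
Qed.

Lemma coefxyXM f i j :
  coefxy (fpsX * f) i j = if i is i'.+1 then coefxy f i' j else 0.
Proof.
rewrite coefxyM big_ord_recl big1 => [|b _]; last by rewrite mul0r.
case: i => [|i]; first by rewrite big_ord0 addr0.
rewrite big_ord_recl big_ord_recl /= mul1r !subn0 subSS subn0 add0r.
rewrite !big1 ?addr0 // => [a _|b _]; last by rewrite mul0r.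
by rewrite big1 // => b _; rewrite mul0r.
Qed.

Lemma coefxyYM f i j :
  coefxy (fpsY * f) i j = if j is j'.+1 then coefxy f i j' else 0.
Proof.
rewrite coefxyM big_ord_recl [X in _ + X]big1 => [|a _]; last first.
  by rewrite big1 // => b _; rewrite mul0r.
rewrite big_ord_recl /= mul0r add0r addr0 subn0.
case: j => [|j]; first by rewrite big_ord0.
rewrite big_ord_recl /= mul1r subSS subn0 big1 ?addr0 // => b _.
by rewrite mul0r.
Qed.

(** Classifies words by their first letter. *)
Lemma word_gfE phi : word_gf phi = fps2_const (phi [::]) +
  fpsX * word_gf (fun s => phi (true :: s)) +
  fpsY * word_gf (fun s => phi (false :: s)).
Proof.
apply: fps2P => i j; rewrite !coefxyD coefxyXM coefxyYM /=.
case: i j => [|i] [|j] /=; rewrite ?addn0 ?add0n ?addr0 ?add0r //=.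
- by rewrite word_sum_gt ?add0r.
- by rewrite addnS addrC.
Qed.

Lemma word_gfZ c phi : word_gf (fun s => c * phi s) = fps2_const c * word_gf phi.
Proof. by apply: fps2P => i j; rewrite coefxyCM /= word_sumZ. Qed.

Lemma eq_word_gf phi psi : phi =1 psi -> word_gf phi = word_gf psi.
Proof. by move=> E; apply: fps2P => i j; apply: eq_word_sum. Qed.

Lemma word_gf0 : word_gf (fun=> 0) = 0.
Proof.
rewrite -[RHS](mul0r (word_gf (fun=> 0))) (_ : 0 = fps2_const 0) // -word_gfZ.
by apply: eq_word_gf => s; rewrite mul0r.
Qed.

(** * Sequences of runs and gaps *)

(** A block is a nonempty run of [true] followed by at least two [false]. The
    value of [block_scan m 0 0 s] is the weight of s when s is a sequence of m
    + 1 blocks, and 0 otherwise. The automaton is inside a block of which it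
    has read r letters [true] and g letters [false], and m blocks have to
    follow. The weight of the run is paid at the end of the block. *)
Fixpoint block_scan (m r g : nat) (s : seq bool) : rat :=
  match s with
  | [::] => if (m == 0%N) && (1 < g)%N then run_weight r else 0
  | true :: s' =>
      if g == 0%N then block_scan m r.+1 0 s'
      else if (1 < g)%N then
        (if m is m'.+1 then run_weight r * block_scan m' 1 0 s' else 0)
      else 0
  | false :: s' => if r == 0%N then 0 else block_scan m r g.+1 s'
  end.

Definition run_series : fps2 := (fps2_exp (2 * fpsX) - 1) / 2.
Definition gap_series : fps2 := fpsY ^+ 2 / (1 - fpsY).

Lemma coefxyXX m i j : coefxy (fpsX ^+ m) i j = ((i == m) && (j == 0%N))%:R.
Proof.
elim: m i => [|m IH] i; first by rewrite expr0 coefxy1.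
by rewrite exprS coefxyXM; case: i.
Qed.

Lemma fps2_constX c m : fps2_const c ^+ m = fps2_const (c ^+ m).
Proof.
elim: m => [|m IH]; first by [].
rewrite !exprS IH; apply: fps2P => i j; rewrite coefxyCM /=.
by case: ifP; rewrite ?mulr0.
Qed.

Lemma coefxy_half f i j : coefxy (f / 2) i j = coefxy f i j / 2.
Proof.
have U2 : (2 : fps2) \is a GRing.unit by rewrite fps2_unitE.
rewrite -[in RHS](divrK U2 f) (mulrC (f / 2) 2) fps2_natr coefxyCM.
by rewrite mulrAC mulfV ?mul1r.
Qed.

Lemma coefxy_run_series i j : coefxy run_series i j =
  if (0 < i)%N && (j == 0%N) then run_weight i else 0.
Proof.
have e2X m : (2 * fpsX) ^+ m = fps2_const (2 ^+ m) * fpsX ^+ m.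
  by rewrite exprMn fps2_natr fps2_constX.
rewrite /run_series coefxy_half coefxyB coefxy1 /fps2_exp.
rewrite (@coefxy_subst _ _ _ _ (i + j).+1) //; last first.
  by rewrite fps2_natr coefxyCM mulr0.
under eq_bigr => m _ do rewrite e2X coefxyCM coefxyXX.
have im : (i < (i + j).+1)%N by rewrite ltnS leq_addr.
rewrite (bigD1 (Ordinal im)) //= eqxx big1 ?addr0 => [|m mi]; last first.
  by rewrite eq_sym -val_eqE /= in mi; rewrite (negPf mi) !mulr0.
case: j im => [|j] im; last by rewrite !andbF !mulr0 subr0 mul0r.
case: i im => [|i] im; first by rewrite /= !mulr1 invr1 subrr mul0r.
by rewrite /= subr0 mulr1 exprS mulrC mulrCA mulKf // mulrC.
Qed.

Lemma coefxy_run_seriesM f i j : coefxy (run_series * f) i j =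
  \sum_(a < i) run_weight a.+1 * coefxy f (i - a.+1) j.
Proof.
rewrite coefxyM big_ord_recl [X in X + _]big1 ?add0r => [|b _]; last first.
  by rewrite coefxy_run_series mul0r.
apply: eq_bigr => a _; rewrite big_ord_recl big1 ?addr0 => [|b _]; last first.
  by rewrite coefxy_run_series mul0r.
by rewrite coefxy_run_series subn0.
Qed.

Lemma gap_seriesK : gap_series * (1 - fpsY) = fpsY ^+ 2.
Proof. by rewrite divrK // fps2_unitE coefxyB coefxy1. Qed.

Lemma coefxy_blocks00 : coefxy (run_series * gap_series) 0 0 = 0.
Proof. by rewrite coefxy_run_seriesM big_ord0. Qed.

(** Once a gap has length 2, its exact length does not matter, and the weight
    of the run before it factors out. *)
Lemma block_scan_gap m r g s : (0 < r)%N ->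
  block_scan m r g.+2 s = run_weight r * block_scan m 1 2 s.
Proof.
move=> r0; elim: s m r g r0 => [|[] s IH] m r g r0 /=.
- by rewrite andbT; case: ifP; rewrite ?mulr1 // mulr0.
- by case: m => [|m]; rewrite ?mulr0 // mulrA mulr1.
- by rewrite (gtn_eqF r0) IH // [in RHS]IH // mulrA mulr1.
Qed.

(** In a gap of length at least 2, the word ends, or the gap grows, or the
    next block begins. *)
Lemma gap_gf m : word_gf (block_scan m 1 2) * (1 - fpsY) =
  if m is m'.+1 then fpsX * word_gf (block_scan m' 1 0) else 1.
Proof.
rewrite mulrBr mulr1 {1}word_gfE /=.
rewrite [X in _ + fpsY * X](_ : _ = word_gf (block_scan m 1 2)); last first.
  by apply: eq_word_gf => s; rewrite block_scan_gap // mul1r.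
rewrite [_ * fpsY]mulrC addrK; case: m => [|m] /=; last first.
  rewrite (_ : fps2_const 0 = 0) // add0r; congr (_ * _).
  by apply: eq_word_gf => s; rewrite mul1r.
by rewrite word_gf0 mulr0 addr0.
Qed.

(** Inside a run, either the run grows or two letters [false] follow. *)
Lemma block_gf_step m r : (0 < r)%N -> word_gf (block_scan m r 0) =
  fpsX * word_gf (block_scan m r.+1 0) +
  fps2_const (run_weight r) * (fpsY ^+ 2 * word_gf (block_scan m 1 2)).
Proof.
move=> r0; rewrite word_gfE /= andbF (_ : fps2_const 0 = 0) // add0r.
congr (_ + _); rewrite (gtn_eqF r0) word_gfE /= andbF.
rewrite (_ : fps2_const 0 = 0) // add0r word_gf0 mulr0 add0r.
rewrite (gtn_eqF r0)
  (_ : word_gf _ = fps2_const (run_weight r) * word_gf (block_scan m 1 2)).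
  by rewrite expr2 -mulrA !(mulrCA (fps2_const _)).
by rewrite -word_gfZ; apply: eq_word_gf => s; rewrite block_scan_gap.
Qed.

(** Unfolds [block_gf_step] along the run that is being read: a is the number
    of letters [true] still to come in it. *)
Lemma coefxy_block_gf m r i j : (0 < r)%N ->
  coefxy (word_gf (block_scan m r 0)) i j =
  \sum_(a < i.+1) run_weight (r + a) *
     coefxy (fpsY ^+ 2 * word_gf (block_scan m 1 2)) (i - a) j.
Proof.
elim: i r => [|i IH] r r0; rewrite block_gf_step // coefxyD coefxyXM coefxyCM.
  by rewrite add0r big_ord1 addn0.
rewrite IH // [RHS]big_ord_recl addn0 subn0 addrC; congr (_ + _).
by apply: eq_bigr => a _; rewrite addSnnS.
Qed.

Lemma run_gf m : fpsX * word_gf (block_scan m 1 0) =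
  run_series * (fpsY ^+ 2 * word_gf (block_scan m 1 2)).
Proof.
apply: fps2P => i j; rewrite coefxyXM coefxy_run_seriesM.
case: i => [|i]; first by rewrite big_ord0.
by rewrite coefxy_block_gf.
Qed.

(** Sequences of m + 1 blocks are generated by a power of the series of one
    block. *)
Lemma word_gf_block_scan m :
  word_gf (block_scan m 0 0) = (run_series * gap_series) ^+ m.+1.
Proof.
have E k : word_gf (block_scan k 0 0) = fpsX * word_gf (block_scan k 1 0).
  rewrite word_gfE /= andbF (_ : fps2_const 0 = 0) // add0r.
  by rewrite word_gf0 mulr0 addr0.
have G k : fpsY ^+ 2 * word_gf (block_scan k 1 2) =
    gap_series * (word_gf (block_scan k 1 2) * (1 - fpsY)).
  by rewrite -gap_seriesK -!mulrA [(1 - _) * _]mulrC.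
rewrite E; elim: m => [|m IH]; rewrite run_gf G gap_gf mulrA.
  by rewrite mulr1 expr1.
by rewrite IH -exprS.
Qed.

(** No letter [false] may stand between two letters [true]. The letters a and
    b precede s and, cyclically, [true] follows it; moreover s has to end with
    [false]. *)
Fixpoint gaps_ok (a b : bool) (s : seq bool) : bool :=
  if s is c :: s' then ~~ [&& a, ~~ b & c] && gaps_ok b c s' else ~~ a && ~~ b.

(** The letter b precedes the word. *)
Fixpoint block_number (b : bool) (s : seq bool) : nat :=
  if s is c :: s' then ((c && ~~ b) + block_number c s')%N else 0%N.

Lemma gaps_ok_true a s : gaps_ok a true s = gaps_ok true true s.
Proof. by case: s => [|c s] /=; rewrite !andbF. Qed.

(** The automaton computes a product of three separate features of the word.
    The letters before s are the end of a run when g = 0, of a gap of length 1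
    when g = 1, and of a longer gap otherwise. *)
Lemma block_scanE m r g s : (0 < r)%N -> block_scan m r g s =
  (gaps_ok (g <= 1)%N (g == 0%N) s && (block_number (g == 0%N) s == m))%:R *
  (if g == 0%N then word_weight r s else run_weight r * word_weight 0 s).
Proof.
elim: s m r g => [|[] s IH] m r [|[|g]] r0 //=; rewrite ?andbF ?mul0r //.
- by rewrite eq_sym andbT; case: ifP; rewrite ?mul0r // mul1r mulr1.
- by rewrite IH.
- case: m => [|m]; first by rewrite andbF mul0r.
  by rewrite IH //= gaps_ok_true add1n eqSS mulrCA.
- by rewrite (gtn_eqF r0) IH.
- by rewrite (gtn_eqF r0) IH //= mul1r.
- by rewrite (gtn_eqF r0) IH //= mul1r.
Qed.

Lemma gaps_okP a b s : gaps_ok a b s <-> last b s = false /\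
  forall i, (i <= size s)%N -> ~~ [&& nth false [:: a, b & rcons s true] i,
    ~~ nth false (b :: rcons s true) i & nth false (rcons s true) i].
Proof.
elim: s a b => [|c s IH] a b /=.
  split=> [/andP[a0 b0]|[b0 /(_ 0%N isT)]]; last by rewrite /= b0 !andbT.
  by split; [apply/negbTE|case=> [|i] //; rewrite (negPf a0)].
split=> [/andP[abc /IH[lc H]]|[lc H]].
  by split=> // -[|i] // i_s; apply: H.
by have /= -> := H 0%N isT; apply/IH; split=> // i i_s; apply: (H i.+1).
Qed.

Lemma block_numberE b s : block_number b s =
  (\sum_(0 <= i < size s) (nth false s i && ~~ nth false (b :: s) i))%N.
Proof.
elim: s b => [|c s IH] b /=; first by rewrite big_nil.
by rewrite big_nat_recl // IH.
Qed.

Lemma block_scan_start m s : block_scan m 0 0 s =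
  [&& head false s, gaps_ok false false s & block_number false s == m.+1]%:R *
  word_weight 0 s.
Proof.
case: s => [|[] s] /=; rewrite ?mul0r ?andbF //.
by rewrite block_scanE //= gaps_ok_true add1n eqSS.
Qed.

(** * Good sequences of removals *)

Lemma set_of_nil (T : finType) : [set x in ([::] : seq T)] = set0.
Proof. by apply/setP => x; rewrite !inE. Qed.

Lemma sum_tuple_cons (T : finType) n (F : seq T -> rat) :
  \sum_(t : n.+1.-tuple T) F t = \sum_x \sum_(t : n.-tuple T) F (x :: t).
Proof.
rewrite pair_big /= (reindex (fun xt : T * n.-tuple T => cons_tuple xt.1 xt.2)) //.
exists (fun t => (thead t, behead_tuple t)) => [[x t]|t] _ /=.
  by congr (_, _); apply: val_inj.
by rewrite [RHS]tuple_eta; apply: val_inj.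
Qed.

Lemma sum_tuple0 (T : finType) (F : seq T -> rat) :
  \sum_(t : 0.-tuple T) F t = F [::].
Proof.
rewrite (bigD1 (nil_tuple T)) //= big1 ?addr0 // => t /eqP[].
exact: tuple0.
Qed.

Lemma card_Zn p : #|'Z_p.+3| = p.+3.
Proof. exact: card_ord. Qed.

(** B is the set of the removed vertices. *)
Definition gapped p (B : {set 'Z_p.+3}) : bool := ~~ has_isolated (~: B).

Lemma gappedP p (B : {set 'Z_p.+3}) :
  reflect (forall v, ~~ [&& v \notin B, v - 1 \in B & v + 1 \in B]) (gapped B).
Proof.
rewrite /gapped negb_exists; apply: (iffP forallP) => H v; move: (H v);
  apply: contra; rewrite /isolated_in in_setC.
- case/and3P=> vB v1 v2; rewrite vB; apply/forallP => u; apply/implyP.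
  by rewrite in_setC negbK => /orP[] /eqP->.
- case/andP=> -> /forallP A; move: (A (v - 1)) (A (v + 1)).
  by rewrite /cycle_adj !eqxx orbT /= !in_setC !negbK => -> ->.
Qed.

Lemma gapped0 p : gapped (@set0 'Z_p.+3).
Proof. by apply/gappedP => v; rewrite !inE. Qed.

(** The head of u is the vertex removed last, so that the stages of the
    removal are the suffixes of u; the first k of them are tested. *)
Fixpoint good_removal p (k : nat) (u : seq 'Z_p.+3) : bool :=
  if u is v :: u' then
    [&& v \notin u', (size u <= k)%N ==> gapped [set x in u] & good_removal k u']
  else true.

(** Sorts the good orders of removal of B by the vertex removed last; this is
    0 unless B has m elements. *)
Fixpoint removal_count p (m : nat) (B : {set 'Z_p.+3}) : rat :=
  if m is m'.+1 then
    (gapped B)%:R * \sum_(v in B) removal_count m' (B :\ v)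
  else (B == set0)%:R.

Lemma good_removal_uniq p k (u : seq 'Z_p.+3) : good_removal k u -> uniq u.
Proof. by elim: u => //= v u IH /and3P[-> _ /IH]. Qed.

Lemma good_removalP p k (u : seq 'Z_p.+3) :
  good_removal k u <->
  uniq u /\ forall j, (size u - j <= k)%N -> gapped [set x in drop j u].
Proof.
elim: u => [|v u IH] /=.
  split=> // _; split=> // j _; rewrite set_of_nil; exact: gapped0.
split=> [/and3P[vu /implyP g /IH[uu H]]|[/andP[vu uu] H]].
  by split; [rewrite vu|case=> [|j]; [rewrite subn0|rewrite subSS; exact: H]].
rewrite vu /=; apply/andP; split.
  by apply/implyP => sk; have := H 0%N; rewrite subn0; apply.
by apply/IH; split=> // j jk; apply: (H j.+1).
Qed.

Lemma removal_countE p k m (B : {set 'Z_p.+3}) : (m <= k)%N ->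
  removal_count m B =
  \sum_(u : m.-tuple 'Z_p.+3) (good_removal k u && ([set x in u] == B))%:R.
Proof.
pose F B (u : seq 'Z_p.+3) : rat := (good_removal k u && ([set x in u] == B))%:R.
elim: m B => [|m IH] B mk.
  by rewrite (sum_tuple0 (F B)) /F set_of_nil /= eq_sym.
rewrite -[RHS]/(\sum_(u : m.+1.-tuple 'Z_p.+3) F B u).
rewrite (@sum_tuple_cons _ _ (F B)) /= mulr_sumr big_mkcond.
apply: eq_bigr => v _.
have key (u : m.-tuple 'Z_p.+3) : F B (v :: u) =
    (gapped B && (v \in B))%:R * F (B :\ v) u.
  rewrite /F -natrM mulnb /= size_tuple mk /=; congr (_%:R); congr nat_of_bool.
  have -> : [set x in v :: u] = v |: [set x in u].
    by apply/setP => x; rewrite !inE.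
  rewrite -!andbA; apply/and4P/and4P => [|[gB vB gu /eqP uB]].
    case=> vu g gu /eqP uB; rewrite -uB g setU11 gu setU1K ?eqxx //.
    by rewrite inE.
  have uE : v |: [set x in u] = B by rewrite uB setD1K.
  by split; rewrite ?uE //; move: (setD11 v B); rewrite -uB inE => ->.
under eq_bigr => u _ do rewrite key.
rewrite -mulr_sumr; case: (v \in B); rewrite ?andbF ?mul0r // andbT.
by rewrite IH // ltnW.
Qed.

Lemma sum_good_removal p k :
  \sum_(u : k.-tuple 'Z_p.+3) (good_removal k u)%:R =
  \sum_(B : {set 'Z_p.+3}) removal_count k B.
Proof.
under [RHS]eq_bigr => B _ do rewrite (@removal_countE _ k) //.
rewrite exchange_big /=; apply: eq_bigr => u _.
rewrite (bigD1 [set x in u]) //= eqxx andbT big1 ?addr0 // => B.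
by rewrite eq_sym => /negPf ->; rewrite andbF.
Qed.

(** After k removals there are no more conditions: any of the remaining
    vertices may be removed next. *)
Lemma sum_good_removalS p k m : (k <= m)%N ->
  \sum_(u : m.+1.-tuple 'Z_p.+3) (good_removal k u)%:R =
  (p.+3 - m)%:R * \sum_(u : m.-tuple 'Z_p.+3) (good_removal k u)%:R :> rat.
Proof.
move=> km; rewrite (@sum_tuple_cons _ _ (fun u => (good_removal k u)%:R)) exchange_big.
rewrite mulr_sumr; apply: eq_bigr => u _ /=.
rewrite size_tuple ltnNge km /=; case gu: (good_removal k u); last first.
  by rewrite mulr0 big1 // => v _; rewrite andbF.
rewrite mulr1; under eq_bigr => v _ do rewrite andbT.
rewrite -natr_sum; congr (_%:R).
have <- : #|[predC u]| = (p.+3 - m)%N.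
  have := cardC (mem u); rewrite (card_uniqP (good_removal_uniq gu)) size_tuple.
  by move/(fun e => etrans e (card_Zn p)) => e; rewrite -(addKn m #|_|) e.
rewrite -sum1_card [RHS]big_mkcond; apply: eq_bigr => v _.
by rewrite !inE; case: ifP.
Qed.

Lemma sum_good_removal_fact p k m : (k <= m <= p.+3)%N ->
  (p.+3 - m)`!%:R * \sum_(u : m.-tuple 'Z_p.+3) (good_removal k u)%:R =
  (p.+3 - k)`!%:R * \sum_(B : {set 'Z_p.+3}) removal_count k B.
Proof.
elim: m => [|m IH] /andP[km mp].
  by move: km; rewrite leqn0 => /eqP->; rewrite sum_good_removal.
move: km; rewrite leq_eqVlt => /orP[/eqP->|km]; first by rewrite sum_good_removal.
rewrite sum_good_removalS // mulrA -natrM -IH ?(ltnW mp) ?andbT //.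
by rewrite -(subnSK mp) factS [in RHS]mulnC.
Qed.

Lemma occupied_compl p (s : (p.+3).-tuple 'Z_p.+3) t : uniq s ->
  occupied s t = ~: [set x in drop t s].
Proof.
move=> us; apply/setP => x; rewrite !inE.
have xs : x \in tval s.
  have [||_ ->] := uniq_min_size us (s2 := enum 'Z_p.+3); rewrite ?mem_enum //.
    by move=> y _; rewrite mem_enum.
  by rewrite -cardE card_Zn size_tuple.
have := us; rewrite -{1}(cat_take_drop t s) cat_uniq => /and3P[_ /hasPn H _].
have := xs; rewrite -{1}(cat_take_drop t s) mem_cat.
case xd: (x \in drop t s); last by rewrite orbF.
by move: (H _ xd) => /negPf ->.
Qed.

Lemma gapped_drop p (s : (p.+3).-tuple 'Z_p.+3) t : uniq s ->
  gapped [set x in drop t s] = ~~ has_isolated (occupied s t).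
Proof. by move=> us; rewrite occupied_compl. Qed.

(** Makes the maximum in [tau] range over a nonempty set. *)
Lemma has_isolated_occupied1 p (s : (p.+3).-tuple 'Z_p.+3) :
  has_isolated (occupied s 1).
Proof.
apply/existsP; exists (thead s); rewrite /isolated_in /occupied.
case/tupleP: s => v s; rewrite theadE /= take0 inE mem_seq1 eqxx.
apply/forallP => u; apply/implyP; rewrite inE mem_seq1.
by case/orP=> /eqP->; rewrite -subr_eq0 addrAC subrr add0r ?oppr_eq0 oner_eq0.
Qed.

(** The time t of an ordering s is the stage at which [drop t s] has been
    removed. *)
Lemma K_gt p (s : (p.+3).-tuple 'Z_p.+3) k : uniq s ->
  (k < K s)%N = good_removal k s.
Proof.
move=> us; rewrite /K ltn_subRL addnC; apply/idP/idP => [tk|/good_removalP[_ H]].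
  apply/good_removalP; split=> // j; rewrite size_tuple => jk.
  rewrite gapped_drop //; apply/negP => iso.
  have [jn|nj] := ltnP j p.+4; last first.
    move: iso; apply/negP; rewrite -gapped_drop // drop_oversize ?set_of_nil ?gapped0 //.
    by rewrite size_tuple ltnW.
  have : (j <= tau s)%N.
    pose iso_at (t : 'I_p.+4) := has_isolated (occupied s t).
    by rewrite /tau (@leq_bigmax_cond _ iso_at _ (Ordinal jn)).
  by move: tk jk; lia.
have iso_lt t : has_isolated (occupied s t) -> (t + k < p.+3)%N.
  move=> iso; rewrite ltnNge; apply/negP => nt.
  have := H t; rewrite size_tuple gapped_drop // iso; move/(_ _)/negP; apply => //.
  by lia.
have k1 := iso_lt _ (has_isolated_occupied1 s).
suff : (tau s <= p.+3 - k.+1)%N by lia.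
by apply/bigmax_leqP => t /iso_lt; lia.
Qed.

Lemma Q_removal_count p k : (k <= p.+3)%N ->
  Q p.+3 k = (\sum_(B : {set 'Z_p.+3}) removal_count k B) / k`!%:R.
Proof.
move=> kn.
have cnt j : #|[set s in orderings p.+3 | (j < K s)%N]|%:R =
    \sum_(s : (p.+3).-tuple 'Z_p.+3) (good_removal j s)%:R :> rat.
  rewrite -sum1_card natr_sum big_mkcond; apply: eq_bigr => s _.
  rewrite !inE; case us: (uniq s) => /=; last first.
    by case g: (good_removal j s) => //; rewrite (good_removal_uniq g) in us.
  by rewrite K_gt //; case: ifP.
have tot j : (j <= p.+3)%N ->
    \sum_(s : (p.+3).-tuple 'Z_p.+3) (good_removal j s)%:R =
    (p.+3 - j)`!%:R * \sum_(B : {set 'Z_p.+3}) removal_count j B.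
  by move=> jn; rewrite -(@sum_good_removal_fact _ _ p.+3) ?jn ?leqnn // subnn mul1r.
have -> : Q p.+3 k = 'C(p.+3, k)%:R *
    ((p.+3 - k)`!%:R * (\sum_(B : {set 'Z_p.+3}) removal_count k B) /
       (p.+3)`!%:R).
  rewrite /Q /Pr cnt tot //; congr (_ * (_ / _)).
  (* Every ordering satisfies the empty condition on 0 removals. *)
  have -> : orderings p.+3 = [set s in orderings p.+3 | (0 < K s)%N].
    apply/setP => s; rewrite !inE; case us: (uniq s) => //=.
    rewrite K_gt //; apply/esym/good_removalP; split=> // j; rewrite leqn0 => /eqP j0.
    by rewrite drop_oversize ?set_of_nil ?gapped0 // -subn_eq0 j0.
  rewrite cnt tot // subn0 (bigD1 set0) //= eqxx big1 ?addr0 ?mulr1 // => B /negPf->.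
  by [].
have f0 m : m`!%:R != 0 :> rat by rewrite Num.Theory.pnatr_eq0 -lt0n fact_gt0.
apply: (mulIf (f0 k)); rewrite divfK // -(bin_fact kn) !natrM.
have c0 : 'C(p.+3, k)%:R != 0 :> rat by rewrite Num.Theory.pnatr_eq0 -lt0n bin_gt0.
by field; rewrite c0 !f0.
Qed.

(** * Subsets of the cycle as words *)

Lemma sum_word_tuple n k (phi : seq bool -> rat) :
  \sum_(t : n.-tuple bool | count id t == k) phi t = word_sum n k phi.
Proof.
elim: n k phi => [|n IH] k phi; rewrite big_mkcond.
  by rewrite (@sum_tuple0 _ (fun t => if count id t == k then phi t else 0)) eq_sym.
rewrite (@sum_tuple_cons _ _ (fun t => if count id t == k then phi t else 0)).
rewrite big_bool /= addrC; congr (_ + _).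
  by rewrite -IH [RHS]big_mkcond.
case: k => [|k]; first by rewrite big1.
by rewrite -IH [RHS]big_mkcond.
Qed.

(** The cycle is cut before 0. *)
Definition set_word p (B : {set 'Z_p.+3}) : seq bool :=
  mkseq (fun i => (inord i : 'Z_p.+3) \in B) p.+3.

Lemma size_set_word p (B : {set 'Z_p.+3}) : size (set_word B) = p.+3.
Proof. exact: size_mkseq. Qed.

Lemma nth_set_word p (B : {set 'Z_p.+3}) (v : 'Z_p.+3) :
  nth false (set_word B) v = (v \in B).
Proof. by rewrite nth_mkseq ?inord_val. Qed.

Lemma count_set_word p (B : {set 'Z_p.+3}) : count id (set_word B) = #|B|.
Proof.
rewrite -sum1_count big_map -[iota _ _]/(index_iota 0 p.+3) big_mkord.
by rewrite -sum1_card; apply: eq_bigl => i; rewrite inord_val.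
Qed.

Lemma sum_set_word p k (phi : seq bool -> rat) :
  \sum_(B : {set 'Z_p.+3} | #|B| == k) phi (set_word B) = word_sum p.+3 k phi.
Proof.
rewrite -sum_word_tuple.
pose h (B : {set 'Z_p.+3}) : (p.+3).-tuple bool :=
  Tuple (introT eqP (size_set_word B)).
pose g (t : (p.+3).-tuple bool) := [set v : 'Z_p.+3 | nth false t v].
rewrite (reindex h) /=; first by apply: eq_bigl => B; rewrite -count_set_word.
exists g => [B _|t _]; first by apply/setP => v; rewrite inE nth_set_word.
apply/val_inj/(@eq_from_nth _ false); rewrite ?size_set_word ?size_tuple // => i ip.
have -> : i = (Ordinal ip : 'Z_p.+3) by [].
by rewrite nth_set_word inE.
Qed.

Lemma val_Zn_succ p (v : 'Z_p.+3) : v != -1 -> (v + 1 : 'Z_p.+3) = v.+1 :> nat.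
Proof.
move=> v1; have vp : (v < p.+2)%N.
  rewrite ltn_neqAle -ltnS ltn_ord andbT; apply: contra v1 => /eqP vE.
  by apply/eqP/val_inj; rewrite /= vE modn_small // subn1 /= modn_small.
by rewrite /= (modn_small (isT : 1 < p.+3)%N) addn1 modn_small.
Qed.

(** When -1 lies outside B, the letter [false] put before the word stands for
    the vertex -1, so that neighbours on the cycle are neighbours here. *)
Lemma nth_set_word_prev p (B : {set 'Z_p.+3}) (v : 'Z_p.+3) : -1 \notin B ->
  nth false (false :: set_word B) v = (v - 1 \in B).
Proof.
move=> B1; have [->|v0] := eqVneq v 0; first by rewrite sub0r (negPf B1).
have -> : v = (v - 1 : 'Z_p.+3)%R.+1 :> nat.
  rewrite -val_Zn_succ ?subrK //; apply: contra v0 => /eqP /(congr1 (+%R^~ 1)).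
  by rewrite subrK addNr => ->.
exact: nth_set_word.
Qed.

Lemma last_set_word p (B : {set 'Z_p.+3}) : last false (set_word B) = (-1 \in B).
Proof.
rewrite -nth_last size_set_word -nth_set_word; congr nth.
by rewrite /= (modn_small (isT : 1 < p.+3)%N) subn1 modn_small.
Qed.

(** * Good orders of a given set *)

Lemma subr1_neq p (v : 'Z_p.+3) : v - 1 != v.
Proof. by rewrite -subr_eq0 addrAC subrr add0r oppr_eq0 oner_eq0. Qed.

Lemma addr1_neq p (v : 'Z_p.+3) : v + 1 != v.
Proof. by rewrite -subr_eq0 addrAC subrr add0r oner_eq0. Qed.

(** Putting v back can only isolate v itself. *)
Lemma gapped_setD1 p (B : {set 'Z_p.+3}) v : gapped B -> v \in B ->
  gapped (B :\ v) = ~~ ((v - 1 \in B) && (v + 1 \in B)).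
Proof.
move=> /gappedP gB vB; apply/gappedP/idP => [/(_ v)|vN u].
  by rewrite !inE eqxx subr1_neq addr1_neq.
rewrite !inE; have [->|uv] := eqVneq u v; first by rewrite subr1_neq addr1_neq.
apply/negP => /and3P[/= uB /andP[_ u1] /andP[_ u2]].
by move: (gB u); rewrite uB u1 u2.
Qed.

Lemma exposed_set_word p (B : {set 'Z_p.+3}) (v : 'Z_p.+3) : -1 \notin B -> v \in B ->
  exposed (set_word B) v = ~~ ((v - 1 \in B) && (v + 1 \in B)).
Proof.
move=> B1 vB; rewrite /exposed nth_set_word_prev // -val_Zn_succ ?nth_set_word //.
by apply: contra B1 => /eqP <-.
Qed.

Lemma set_word_setD1 p (B : {set 'Z_p.+3}) (v : 'Z_p.+3) :
  set_word (B :\ v) = set_nth false (set_word B) v false.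
Proof.
apply: (@eq_from_nth _ false).
  by rewrite size_set_nth !size_set_word (maxn_idPr (ltn_ord v)).
rewrite size_set_word => i ip; rewrite nth_set_nth /=.
rewrite -[i]/(nat_of_ord (Ordinal ip : 'Z_p.+3)) !nth_set_word !inE.
by rewrite -val_eqE /=; case: eqP.
Qed.

(** Induction on the vertex v removed last. By [gapped_setD1] it ranges over
    the vertices of B that do not have both neighbours in B, which are the
    exposed letters of the word, and [sum_word_weight_exposed] adds up their
    contributions. The vertex -1 stays outside the set in the induction. *)
Lemma removal_count_word p m (B : {set 'Z_p.+3}) : -1 \notin B ->
  removal_count m B =
    if (#|B| == m) && gapped B then m`!%:R * word_weight 0 (set_word B) else 0.
Proof.
elim: m B => [|m IH] B B1; rewrite [removal_count _ _]/=.
  rewrite cards_eq0; have [->|//] := eqVneq B set0; rewrite gapped0 mul1r.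
  suff -> : set_word (@set0 'Z_p.+3) = nseq p.+3 false.
    by elim: p.+3 {B B1} => //= n <-; rewrite mul1r.
  apply: (@eq_from_nth _ false); rewrite ?size_set_word ?size_nseq // => i ip.
  by rewrite nth_nseq ip nth_mkseq // inE.
case gB: (gapped B); last by rewrite mul0r andbF.
rewrite mul1r andbT.
under eq_bigr => v vB do rewrite IH ?inE ?(negPf B1) ?andbF //.
case: ifP => Bm; last first.
  by rewrite big1 // => v vB; move: Bm; rewrite (cardsD1 v) vB add1n eqSS => ->.
rewrite factS mulnC natrM -mulrA -(eqP Bm) -count_set_word.
rewrite -sum_word_weight_exposed ?last_set_word; last exact: negbTE.
rewrite size_set_word big_mkord mulr_sumr big_mkcond [RHS]big_mkcond.
apply: eq_bigr => v _; rewrite nth_set_word.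
case vB: (v \in B) => //; rewrite andTb exposed_set_word // gapped_setD1 //.
rewrite set_word_setD1.
by move: Bm; rewrite (cardsD1 v) vB add1n eqSS => ->.
Qed.

(** * Summation over the sets by cutting at a run *)

Definition rotation p (c : 'Z_p.+3) (B : {set 'Z_p.+3}) : {set 'Z_p.+3} :=
  [set v | v + c \in B].

Lemma rotationK p (c : 'Z_p.+3) : cancel (rotation c) (rotation (- c)).
Proof. by move=> B; apply/setP => v; rewrite !inE subrK. Qed.

Lemma gapped_rotate p c (B : {set 'Z_p.+3}) : gapped (rotation c B) = gapped B.
Proof.
apply/gappedP/gappedP => H v; last first.
  by rewrite !inE ![v + _ + c]addrAC; apply: H.
have := H (v - c); rewrite !inE !subrK.
by rewrite (addrAC _ (- 1)) (addrAC _ 1) !subrK.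
Qed.

Lemma rotate_eq0 p c (B : {set 'Z_p.+3}) : (rotation c B == set0) = (B == set0).
Proof.
apply/eqP/eqP => [E|->]; last by apply/setP => v; rewrite !inE.
by rewrite -(rotationK c B) E; apply/setP => v; rewrite !inE.
Qed.

Lemma removal_count_rotate p m c (B : {set 'Z_p.+3}) :
  removal_count m (rotation c B) = removal_count m B.
Proof.
elim: m B => [|m IH] B /=; first by rewrite rotate_eq0.
rewrite gapped_rotate [in RHS](reindex_inj (addIr c)); congr (_ * _).
apply: eq_big => v; first by rewrite inE.
move=> _; rewrite -[RHS]IH; congr (removal_count _ _); apply/setP => u; rewrite !inE.
by congr (~~ _ && _); apply/eqP/eqP => [->|/addIr ->].
Qed.

Definition block_starts p (B : {set 'Z_p.+3}) : {set 'Z_p.+3} :=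
  [set v in B | v - 1 \notin B].

Lemma mem_block_starts_rotate p c (B : {set 'Z_p.+3}) v :
  (v \in block_starts (rotation c B)) = (v + c \in block_starts B).
Proof. by rewrite !inE addrAC. Qed.

Lemma card_block_starts_rotate p c (B : {set 'Z_p.+3}) :
  #|block_starts (rotation c B)| = #|block_starts B|.
Proof.
rewrite -!sum1_card [RHS](reindex_inj (addIr c)); apply: eq_bigl => v.
exact: mem_block_starts_rotate.
Qed.

(** From an element of B one steps back within B forever, around the cycle. *)
Lemma block_starts_eq0 p (B : {set 'Z_p.+3}) :
  block_starts B = set0 -> B = set0 \/ B = setT.
Proof.
move=> E; have [->|[v vB]] := set_0Vmem B; [by left|right].
have step j : v - j%:R \in B.
  elim: j => [|j IH]; first by rewrite subr0.
  have /setP/(_ (v - j%:R)) := E; rewrite !inE IH /= => /negbFE.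
  by rewrite -addrA -opprD natr1.
apply/setP => u; rewrite inE.
have := step (v - u : 'Z_p.+3); rewrite natr_Zp opprB addrC subrK.
by [].
Qed.

Lemma removal_count_ungapped p m (B : {set 'Z_p.+3}) : ~~ gapped B ->
  removal_count m B = 0.
Proof.
move=> /negPf gB; case: m => [|m] /=; last by rewrite gB mul0r.
by case: eqP gB => // ->; rewrite gapped0.
Qed.

(** The vertex that goes last was isolated just before. *)
Lemma removal_count_setT p m : removal_count m [set: 'Z_p.+3] = 0.
Proof.
case: m => [|m] /=.
  by case: eqP => // /setP /(_ 0); rewrite !inE.
rewrite big1 ?mulr0 // => v _; apply: removal_count_ungapped; apply/gappedP => /(_ v).
by rewrite !inE eqxx subr1_neq addr1_neq.
Qed.

(** Every set that contributes has a run, and its count is shared equally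
    among the starts of its runs; rotation invariance moves the chosen start
    to 0. *)
Lemma sum_removal_count_cut p k : (0 < k)%N ->
  \sum_(B : {set 'Z_p.+3}) removal_count k B =
  p.+3%:R * \sum_(B : {set 'Z_p.+3} | 0 \in block_starts B)
              removal_count k B / #|block_starts B|%:R.
Proof.
move=> k0.
transitivity (\sum_(B : {set 'Z_p.+3}) \sum_(c in block_starts B)
                removal_count k B / #|block_starts B|%:R).
  apply: eq_bigr => B _; rewrite sumr_const -[RHS]mulr_natr.
  have [/eqP|s0] := eqVneq #|block_starts B| 0%N; last first.
    by rewrite divfK // Num.Theory.pnatr_eq0.
  rewrite cards_eq0 => /eqP sB; rewrite sB cards0 mulr0.
  have [->|->] := block_starts_eq0 sB; last exact: removal_count_setT.
  case: k k0 => // k _ /=; rewrite big1 ?mulr0 // => v; first by rewrite inE.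
rewrite (exchange_big_dep predT) //=.
under eq_bigr => c _.
  rewrite (reindex_inj (can_inj (rotationK (- c)))).
  under eq_big => [B|B _].
    rewrite mem_block_starts_rotate subrr; over.
    rewrite removal_count_rotate card_block_starts_rotate; over.
  over.
by rewrite sumr_const -[LHS]mulr_natl card_Zn.
Qed.

(** The letter [true] after the word is the vertex 0 again, so the windows of
    three consecutive letters are the neighbourhoods of all vertices. *)
Lemma gapped_word p (B : {set 'Z_p.+3}) : 0 \in B -> -1 \notin B ->
  gapped B = gaps_ok false false (set_word B).
Proof.
move=> B0 B1.
have last_word (v : 'Z_p.+3) : nth false (rcons (set_word B) true) v = (v \in B).
  by rewrite nth_rcons size_set_word ltn_ord nth_set_word.
have next_word (v : 'Z_p.+3) :
    nth false (rcons (set_word B) true) v.+1 = (v + 1 \in B).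
  have [->|v1] := eqVneq v (-1).
    have -> : (-1 : 'Z_p.+3)%R.+1 = p.+3.
      by rewrite /= (modn_small (isT : 1 < p.+3)%N) subn1 modn_small.
    by rewrite addNr B0 nth_rcons size_set_word ltnn eqxx.
  by rewrite -val_Zn_succ // last_word.
have prev_word (v : 'Z_p.+3) :
    nth false (false :: rcons (set_word B) true) v = (v - 1 \in B).
  rewrite -rcons_cons nth_rcons -[size _]/(size (set_word B)).+1.
  rewrite size_set_word leqW ?ltn_ord //.
  exact: nth_set_word_prev.
apply/gappedP/idP => [H|/gaps_okP[_ H] v].
  apply/gaps_okP; split=> [|[|i]]; rewrite ?last_set_word ?size_set_word.
  - exact: negbTE.
  - by [].
  move=> ip; have := H (Ordinal ip : 'Z_p.+3).
  rewrite -prev_word -next_word -last_word /=.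
  by apply: contra => /and3P[-> -> ->].
have := H v.+1; rewrite size_set_word ltn_ord => /(_ isT).
rewrite -prev_word -next_word -last_word.
by apply: contra => /and3P[u1 u2 u3]; apply/and3P.
Qed.

Lemma card_block_starts p (B : {set 'Z_p.+3}) : -1 \notin B ->
  #|block_starts B| = block_number false (set_word B).
Proof.
move=> B1; rewrite block_numberE size_set_word big_mkord -sum1_card big_mkcond.
apply: eq_bigr => v _; rewrite nth_set_word nth_set_word_prev // inE.
by case: ifP.
Qed.

(** The automaton rejects words that do not begin with [true] and end with
    [false], that is, sets in which no run starts at 0. *)
Lemma block_scan_set_word p m (B : {set 'Z_p.+3}) :
  block_scan m 0 0 (set_word B) =
  [&& 0 \in block_starts B, gapped B & #|block_starts B| == m.+1]%:R *
  word_weight 0 (set_word B).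
Proof.
rewrite block_scan_start inE sub0r.
have -> : head false (set_word B) = (0 \in B) by rewrite -nth0 -(nth_set_word B 0).
case B0: (0 \in B) => //; case B1: (-1 \in B).
  suff -> : gaps_ok false false (set_word B) = false by [].
  by apply/negP => /gaps_okP[]; rewrite last_set_word B1.
by rewrite -gapped_word ?B0 ?B1 // -card_block_starts ?B1.
Qed.

(** For each set only the term in which m + 1 is its number of runs is
    nonzero; it supplies the division by that number. *)
Lemma sum_removal_count_blocks p k :
  \sum_(B : {set 'Z_p.+3} | 0 \in block_starts B)
     removal_count k B / #|block_starts B|%:R =
  k`!%:R * \sum_(m < p.+3) m.+1%:R^-1 * word_sum p.+3 k (block_scan m 0 0).
Proof.
under [in RHS]eq_bigr => m _ do rewrite -sum_set_word mulr_sumr.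
rewrite exchange_big mulr_sumr big_mkcond [RHS]big_mkcond.
apply: eq_bigr => B _.
under [in RHS]eq_bigr => m _ do rewrite block_scan_set_word.
case sB: (0 \in block_starts B); last first.
  by case: ifP => // _; rewrite big1 ?mulr0 // => m _; rewrite mul0r mulr0.
have B1 : -1 \notin B by move: sB; rewrite !inE sub0r => /andP[].
rewrite removal_count_word //; move: (word_weight _ _) => W.
case: ifP => /=; last first.
  move=> /negbT; rewrite negb_and mul0r => /orP[/negPf->//|/negPf gB].
  by case: ifP => // _; rewrite big1 ?mulr0 // => m _; rewrite gB mul0r mulr0.
case/andP=> -> gB; rewrite gB /= -mulrA; congr (_ * _).
have s0 : (0 < #|block_starts B|)%N by apply/card_gt0P; exists 0.
have sp : (#|block_starts B|.-1 < p.+3)%N.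
  by rewrite prednK // (leq_trans (max_card _)) ?card_Zn.
rewrite (bigD1 (Ordinal sp)) //= prednK // eqxx [true%:R * W]mul1r mulrC.
rewrite big1 ?addr0 // => m mB.
rewrite -(prednK s0) eqSS eq_sym.
by move: mB; rewrite -val_eqE => /negPf ->; rewrite mul0r mulr0.
Qed.

Theorem corollary3p4 (n : nat) (hn : (3 <= n)%N) :
  Q n 0 = 1 /\
  forall k : nat, (1 <= k <= n)%N ->
    Q n k = n%:R * coefxy
      (fps2_log (1 / (1 - (fps2_exp (2 * fpsX) - 1) / 2
                           * (fpsY ^+ 2 / (1 - fpsY)))))
      k (n - k)%N.
Proof.
case: n hn => [|[|[|p]]] // _; split=> [|k /andP[k0 kp]].
  rewrite Q_removal_count // divr1 (bigD1 set0) //= eqxx big1 ?addr0 // => B.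
  by move=> /negPf ->.
rewrite -/run_series -/gap_series Q_removal_count // sum_removal_count_cut //.
rewrite coefxy_log_inv ?coefxy_blocks00 ?subnKC // -mulrA; congr (_ * _).
rewrite sum_removal_count_blocks mulrAC mulfV ?mul1r; last first.
  by rewrite Num.Theory.pnatr_eq0 -lt0n fact_gt0.
rewrite (@coefxy_subst _ _ _ _ p.+4) ?coefxy_blocks00 ?subnKC //.
(* The index 0 contributes nothing to the logarithm because 0^-1 = 0. *)
rewrite [RHS]big_ord_recl [X in _ = X + _](_ : _ = 0) ?add0r;
  last by rewrite invr0 mul0r.
apply: eq_bigr => m _; congr (_ * _).
by rewrite -word_gf_block_scan /= subnKC.
Qed.
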